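(* Let $N\ge1$ be an integer and let $J:\mathfrak{su}(2)^N\to\mathfrak{su}(2)^N$ be an $\mathbb{R}$-linear map. Then $J$ has zero torsion if and only if there exist $\Phi\in SO(3)^N$ and $M=(\xi^{3i}_{3j})_{1\le i,j\le N}\in\mathfrak{gl}(N,\mathbb{R})$ such that $\Phi^{-1}J\Phi=J(M)$, where $J(M)=(J^i_j(M))_{1\le i,j\le N}$ is the matrix with the following $3\times3$ blocks: $$J^i_i(M)=\begin{pmatrix}0&1&0\\-1&0&0\\0&0&\xi^{3i}_{3i}\end{pmatrix}\ (1\le i\le N),\qquad J^i_j(M)=\begin{pmatrix}0&0&0\\0&0&0\\0&0&\xi^{3i}_{3j}\end{pmatrix}\ (1\le i,j\le N,\ i\ne j).$$
   Context: $\mathfrak{su}(2)^N$ is the direct sum of $N$ copies of $\mathfrak{su}(2)$, with basis $(J^{(1)}_1,J^{(1)}_2,J^{(1)}_3,\dots,J^{(N)}_1,J^{(N)}_2,J^{(N)}_3)$, where for each $k$: $[J^{(k)}_1,J^{(k)}_2]=J^{(k)}_3$, $[J^{(k)}_2,J^{(k)}_3]=J^{(k)}_1$, $[J^{(k)}_3,J^{(k)}_1]=J^{(k)}_2$, and brackets between different factors vanish. Linear maps are identified with their matrices in this basis (columns are images of basis vectors). In $M$ and in block matrices, the upper index is the row index and the lower index the column index; $\mathfrak{gl}(N,\mathbb{R})$ is the set of all real $N\times N$ matrices. $SO(3)^N$ denotes the group of block-diagonal matrices $\mathrm{diag}(\Phi_1,\dots,\Phi_N)$ with $\Phi_i\in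 SO(3)$. A linear map $J:\mathfrak{g}\to\mathfrak{g}$ on a real Lie algebra (not necessarily with $J^2=-1$) has zero torsion if $[JX,JY]-[X,Y]-J[JX,Y]-J[X,JY]=0$ for all $X,Y\in\mathfrak{g}$. *)

(* Defs.v *)
From mathcomp Require Import all_boot all_order all_algebra ring.
From mathcomp Require Import reals.
Set Implicit Arguments.
Unset Strict Implicit.
Unset Printing Implicit Defensive.
Import GRing.Theory.
Local Open Scope ring_scope.

(* Elements of su(2)^N are the columns of their coordinates in the basis
   (J^(1)_1, J^(1)_2, J^(1)_3, ..., J^(N)_1, J^(N)_2, J^(N)_3), seen as N
   consecutive blocks of size 3. *)
Notation su2N R N := 'cV[R]_(\sum_(_ < N) 3)%N.

(* Index arithmetic is modulo 3: this is the bilinear extension of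
   [J_1, J_2] = J_3, [J_2, J_3] = J_1, [J_3, J_1] = J_2 (cf. su2_bracket12,
   su2_bracket23 and su2_bracket31). *)
Definition su2_bracket (R : comNzRingType) (x y : 'cV[R]_3) : 'cV[R]_3 :=
  \col_(a < 3) (x (a + 1) 0 * y (a + 2%:R) 0 - x (a + 2%:R) 0 * y (a + 1) 0).

Definition su2N_bracket (R : comNzRingType) (N : nat) (X Y : su2N R N) :
    su2N R N :=
  \mxcol_(k < N) su2_bracket (submxcol X k) (submxcol Y k).

(* The k-th copy of J_(a+1); both indices start at 0. *)
Definition su2N_basis (R : comNzRingType) (N : nat) (k : 'I_N) (a : 'I_3) :
    su2N R N :=
  \mxcol_(l < N) (if l == k then delta_mx a 0 else 0).

Definition zero_torsion (V : zmodType) (br : V -> V -> V) (J : V -> V) : Prop :=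
  forall X Y : V,
    br (J X) (J Y) - br X Y - J (br (J X) Y) - J (br X (J Y)) = 0.

(* Columns are the images of the basis vectors, unlike in lin1_mx. *)
Definition matrix_of (R : comNzRingType) (n : nat) (f : 'cV[R]_n -> 'cV[R]_n) :
    'M[R]_n :=
  \matrix_(i, j) f (delta_mx j 0) i 0.

Definition SO (R : comNzRingType) (n : nat) (A : 'M[R]_n) : Prop :=
  A^T *m A = 1%:M /\ \det A = 1.

Definition SO3N (R : comNzRingType) (N : nat) (Phi : 'M[R]_(\sum_(_ < N) 3)) :
    Prop :=
  exists2 F : 'I_N -> 'M[R]_3,
    forall i, SO (F i) & Phi = \mxdiag_(i < N) F i.

Definition mx3 (R : comNzRingType) (s : seq (seq R)) : 'M[R]_3 :=
  \matrix_(a < 3, b < 3) (nth [::] s a)`_b.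

(* The entry xi^{3i}_{3j} (upper index: row) is M i j. *)
Definition JM (R : comNzRingType) (N : nat) (M : 'M[R]_N) :
    'M[R]_(\sum_(_ < N) 3) :=
  \mxblock_(i < N, j < N)
    (if i == j then
       mx3 [:: [:: 0; 1; 0];
               [:: -1; 0; 0];
               [:: 0; 0; M i i]]
     else
       mx3 [:: [:: 0; 0; 0];
               [:: 0; 0; 0];
               [:: 0; 0; M i j]]).

Section BracketFacts.
Variable R : comNzRingType.

Lemma su2_bracket12 :
  su2_bracket (delta_mx 0 0) (delta_mx 1 0) = delta_mx 2%:R 0 :> 'cV[R]_3.
Proof.
apply/colP => a; rewrite !mxE.
by case: a => [[|[|[|//]]] ?]; rewrite /=; ring.
Qed.

Lemma su2_bracket23 :
  su2_bracket (delta_mx 1 0) (delta_mx 2%:R 0) = delta_mx 0 0 :> 'cV[R]_3.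
Proof.
apply/colP => a; rewrite !mxE.
by case: a => [[|[|[|//]]] ?]; rewrite /=; ring.
Qed.

Lemma su2_bracket31 :
  su2_bracket (delta_mx 2%:R 0) (delta_mx 0 0) = delta_mx 1 0 :> 'cV[R]_3.
Proof.
apply/colP => a; rewrite !mxE.
by case: a => [[|[|[|//]]] ?]; rewrite /=; ring.
Qed.

Lemma su2_bracketxx (x : 'cV[R]_3) : su2_bracket x x = 0.
Proof. by apply/colP => a; rewrite !mxE; ring. Qed.

Lemma su2_bracketDZl (c : R) (x y z : 'cV[R]_3) :
  su2_bracket (c *: x + y) z = c *: su2_bracket x z + su2_bracket y z.
Proof. by apply/colP => a; rewrite !mxE; ring. Qed.

Lemma su2_bracketDZr (c : R) (x y z : 'cV[R]_3) :
  su2_bracket z (c *: x + y) = c *: su2_bracket z x + su2_bracket z y.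
Proof. by apply/colP => a; rewrite !mxE; ring. Qed.

Lemma su2_jacobi (x y z : 'cV[R]_3) :
  su2_bracket x (su2_bracket y z) + su2_bracket y (su2_bracket z x)
    + su2_bracket z (su2_bracket x y) = 0.
Proof.
apply/colP => a; rewrite !mxE.
have -> : a + 1 + 1 = a + 2%:R by rewrite -addrA.
have -> : a + 1 + 2%:R = a by rewrite -addrA (_ : 1 + 2%:R = 0) ?addr0 //; apply/val_inj.
have -> : a + 2%:R + 1 = a by rewrite -addrA (_ : 2%:R + 1 = 0) ?addr0 //; apply/val_inj.
have -> : a + 2%:R + 2%:R = a + 1 by rewrite -addrA; congr (_ + _); apply/val_inj.
by ring.
Qed.

Lemma su2N_bracket_basis (N : nat) (k l : 'I_N) (a b : 'I_3) :
  su2N_bracket (su2N_basis R k a) (su2N_basis R l b) =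
  if k == l then
    \mxcol_(m < N) (if m == k then su2_bracket (delta_mx a 0) (delta_mx b 0)
                    else 0)
  else 0.
Proof.
have br0l x : su2_bracket 0 x = 0 :> 'cV[R]_3.
  by apply/colP => c; rewrite !mxE; ring.
have br0r x : su2_bracket x 0 = 0 :> 'cV[R]_3.
  by apply/colP => c; rewrite !mxE; ring.
rewrite /su2N_bracket; have [<-|kl] := eqVneq k l.
  by apply/eq_mxcol => m; rewrite !mxcolK; case: eqP => // _; rewrite br0l.
apply/mxcolP => m; rewrite submxcol0 !mxcolK.
by case: (eqVneq m k) => [->|_]; rewrite ?br0l // (negPf kl) br0r.
Qed.

Lemma su2N_basisE (N : nat) (k : 'I_N) (a : 'I_3) :
  su2N_basis R k a = delta_mx (tagnat.Rank k a) 0.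
Proof.
apply/mxcolP => l; rewrite mxcolK; apply/matrixP => b c.
rewrite [RHS]mxE [in RHS]mxE -(inj_eq val_inj (tagnat.Rank l b)) tagnat.eq_Rank.
by case: (l == k); rewrite !mxE.
Qed.

Lemma matrix_ofE (n : nat) (f : {linear 'cV[R]_n -> 'cV[R]_n}) (x : 'cV[R]_n) :
  matrix_of f *m x = f x.
Proof.
rewrite {2}[x]matrix_sum_delta linear_sum /=; apply/colP => i.
rewrite !mxE summxE; apply: eq_bigr => j _.
by rewrite big_ord1 linearZ !mxE mulrC.
Qed.

End BracketFacts.

(* Main.v *)
Require Import Defs.
From mathcomp Require Import all_boot all_order all_algebra ring lra.
From mathcomp Require Import reals.
Set Implicit Arguments.
Unset Strict Implicit.
Unset Printing Implicit Defensive.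
Import Order.TTheory GRing.Theory Num.Theory.
Local Open Scope ring_scope.

(* On one copy of su(2) the bracket is the cross product, so
   [A u, v] + [u, A v] = (tr A - A^T) [u, v] and [A u, A v] = cof(A) [u, v].
   Zero torsion thus becomes cof A - 1 = A (tr A - A^T), which Cayley-Hamilton
   turns into (A + A^T) (A^T - tr A) = 1 - e2, where e2 is the second
   elementary symmetric function of the eigenvalues of A. This has no symmetric
   solution, and once the axis of the antisymmetric part of A is rotated to the
   third axis, it forces the normal form up to a sign, which a half-turn
   corrects. Since rotations are automorphisms of the bracket, one may then
   assume that all diagonal blocks are normal; the component in factor i of the
   torsion on the pairs of factors (j, j) and (j, i) kills all entries of the
   block (i, j) except the last. *)

(** * Indices, determinants and rotations in dimension three *)

Lemma ord3_ind (P : 'I_3 -> Prop) : P 0 -> P 1 -> P 2%:R -> forall i, P i.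
Proof.
move=> P0 P1 P2 [[|[|[|//]]] lti].
- by rewrite (_ : Ordinal _ = 0) //; apply: val_inj.
- by rewrite (_ : Ordinal _ = 1) //; apply: val_inj.
- by rewrite (_ : Ordinal _ = 2%:R) //; apply: val_inj.
Qed.

Lemma big_ord3 (V : nmodType) (F : 'I_3 -> V) :
  \sum_i F i = F 0 + F 1 + F 2%:R.
Proof.
rewrite !big_ord_recl big_ord0 addr0 addrA.
by congr (_ + F _ + F _); apply: val_inj.
Qed.

Lemma ord3_add : (((0 + 1)%R = 1 :> 'I_3) * ((0 + 2%:R)%R = 2%:R :> 'I_3)
  * ((1 + 1)%R = 2%:R :> 'I_3) * ((1 + 2%:R)%R = 0 :> 'I_3)
  * ((2%:R + 1)%R = 0 :> 'I_3) * ((2%:R + 2%:R)%R = 1 :> 'I_3))%type.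
Proof. by do !split; apply: val_inj. Qed.

Lemma det3 (R : comNzRingType) (A : 'M[R]_3) :
  \det A = A 0 0 * (A 1 1 * A 2%:R 2%:R - A 1 2%:R * A 2%:R 1)
         - A 0 1 * (A 1 0 * A 2%:R 2%:R - A 1 2%:R * A 2%:R 0)
         + A 0 2%:R * (A 1 0 * A 2%:R 1 - A 1 1 * A 2%:R 0).
Proof.
have det2 (B : 'M[R]_2) : \det B = B 0 0 * B 1 1 - B 0 1 * B 1 0.
  rewrite (expand_det_row _ 0) !big_ord_recl big_ord0 /cofactor !det_mx11 !mxE /=.
  have E : ((lift ord0 ord0 = 1 :> 'I_2) * (ord0 = 0 :> 'I_2)
            * (lift 0 ord0 = 1 :> 'I_2) * (lift 1 ord0 = 0 :> 'I_2)
            * (lift 0 0 = 1 :> 'I_2) * (lift 1 0 = 0 :> 'I_2))%type.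
    by do !split; apply: val_inj.
  by rewrite !E /=; ring.
rewrite (expand_det_row _ 0) big_ord3 /cofactor !det2 !mxE.
have E : ((lift 0 (0 : 'I_2) = 1 :> 'I_3) * (lift 0 (1 : 'I_2) = 2%:R :> 'I_3)
  * (lift 1 (0 : 'I_2) = 0 :> 'I_3) * (lift 1 (1 : 'I_2) = 2%:R :> 'I_3)
  * (lift 2%:R (0 : 'I_2) = 0 :> 'I_3) * (lift 2%:R (1 : 'I_2) = 1 :> 'I_3))%type.
  by do !split; apply: val_inj.
by rewrite !E /=; ring.
Qed.

(* With [F^T *m F = 1] and [\det F = 1] this says that rotations preserve
   the bracket. *)
Lemma trmx_su2_bracket (R : comNzRingType) (F : 'M[R]_3) (x y : 'cV[R]_3) :
  F^T *m su2_bracket (F *m x) (F *m y) = \det F *: su2_bracket x y.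
Proof.
by apply/colP; apply: ord3_ind;
  rewrite det3 !(mxE, big_ord3, ord3_add); ring.
Qed.

Lemma mulmx_su2_bracket (R : comNzRingType) (F : 'M[R]_3) (x y : 'cV[R]_3) :
  SO F -> F *m su2_bracket x y = su2_bracket (F *m x) (F *m y).
Proof.
move=> [oF dF]; rewrite -[in LHS](scale1r (su2_bracket x y)) -dF.
by rewrite -trmx_su2_bracket mulmxA (mulmx1C oF) mul1mx.
Qed.

(** * The torsion equation on one copy of su(2) *)

Lemma su2_torsion_mx (R : comNzRingType) (A : 'M[R]_3) :
  zero_torsion (@su2_bracket R) (mulmx A) ->
  (A + A^T) *m (A^T - (\tr A)%:M) =
  (1 - (A 0 0 * A 1 1 - A 0 1 * A 1 0 + A 0 0 * A 2%:R 2%:R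
        - A 0 2%:R * A 2%:R 0 + A 1 1 * A 2%:R 2%:R - A 1 2%:R * A 2%:R 1))%:M.
Proof.
move=> TA; apply/matrixP => c d.
(* Modulo 3 one has [e_(d+1), e_(d+2)] = e_d, so coordinate [c] of the torsion on this pair is the
   difference of the two sides at entry (c, d). *)
have /colP/(_ c) := TA (delta_mx (d + 1) 0) (delta_mx (d + 2%:R) 0).
rewrite [RHS in _ = RHS -> _]mxE => H; apply/subr0_eq; rewrite -[RHS]H {H TA}.
move: c d; apply: ord3_ind; apply: ord3_ind;
  by rewrite ?mxE /mxtrace ?(mxE, big_ord3, ord3_add) /=; ring.
Qed.

Lemma su2_torsion_entry (R : comNzRingType) (A : 'M[R]_3) (i j : 'I_3) :
  zero_torsion (@su2_bracket R) (mulmx A) ->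
  (A i 0 + A 0 i) * (A j 0 - (A 0 0 + A 1 1 + A 2%:R 2%:R) *+ (0 == j))
  + (A i 1 + A 1 i) * (A j 1 - (A 0 0 + A 1 1 + A 2%:R 2%:R) *+ (1 == j))
  + (A i 2%:R + A 2%:R i) * (A j 2%:R - (A 0 0 + A 1 1 + A 2%:R 2%:R) *+ (2%:R == j))
  = (1 - (A 0 0 * A 1 1 - A 0 1 * A 1 0 + A 0 0 * A 2%:R 2%:R
        - A 0 2%:R * A 2%:R 0 + A 1 1 * A 2%:R 2%:R - A 1 2%:R * A 2%:R 1)) *+ (i == j).
Proof.
move=> /su2_torsion_mx/matrixP/(_ i j).
by rewrite !mxE big_ord3 !mxE /mxtrace !big_ord3.
Qed.

Lemma su2_torsion_nsym (R : realFieldType) (A : 'M[R]_3) :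
  zero_torsion (@su2_bracket R) (mulmx A) -> A^T != A.
Proof.
move=> TA; apply/eqP => symA.
have s10 : A 1 0 = A 0 1 by rewrite -{1}symA mxE.
have s20 : A 2%:R 0 = A 0 2%:R by rewrite -{1}symA mxE.
have s21 : A 2%:R 1 = A 1 2%:R by rewrite -{1}symA mxE.
have E i j := su2_torsion_entry i j TA.
have := E 0 0; have := E 0 1; have := E 0 2%:R; have := E 1 1; have := E 1 2%:R.
have := E 2%:R 2%:R; rewrite s10 s20 s21 /= => {E TA symA s10 s20 s21}.
move: (A 0 0) (A 0 1) (A 0 2%:R) (A 1 1) (A 1 2%:R) (A 2%:R 2%:R).
move=> a b c d e f; rewrite !mulr0n !mulr1n !subr0 => E22 E12 E11 E02 E01 E00.
pose e2 := a * d - b * b + a * f - c * c + d * f - e * e.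
(* The trace of the torsion equation: for symmetric A the left side has trace 2 (tr(A^2) - (tr A)^2)
   = - 4 e2, the right side 3 (1 - e2). *)
have e2E : e2 = - 3%:R by rewrite /e2; lra.
(* By Cayley-Hamilton [A (A^2 - tr A *: A) = det A - e2 A], so multiplying the
   torsion equation by [A] makes [(e2 + 1) A] scalar. *)
have mE (z x y : R) : x = y -> z * x = z * y by move=> ->.
have b0 : b = 0.
  have : (e2 + 1) * b = 0.
    by have := (mE a _ _ E01, mE b _ _ E11, mE c _ _ E12); case=> -[]; rewrite /e2; lra.
  by rewrite e2E; lra.
have c0 : c = 0.
  have : (e2 + 1) * c = 0.
    by have := (mE a _ _ E02, mE b _ _ E12, mE c _ _ E22); case=> -[]; rewrite /e2; lra.
  by rewrite e2E; lra.
have e0 : e = 0.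
  have : (e2 + 1) * e = 0.
    by have := (mE b _ _ E02, mE d _ _ E12, mE e _ _ E22); case=> -[]; rewrite /e2; lra.
  by rewrite e2E; lra.
have ad : d = a.
  have : (e2 + 1) * (a - d) = 0.
    by have := (mE a _ _ E00, mE d _ _ E11); case; rewrite /e2 b0 c0 e0; lra.
  by rewrite e2E; lra.
have af : f = a.
  have : (e2 + 1) * (a - f) = 0.
    by have := (mE a _ _ E00, mE f _ _ E22); case; rewrite /e2 b0 c0 e0; lra.
  by rewrite e2E; lra.
(* Now A is the scalar matrix a, so e2 = 3 a^2, which cannot be -3. *)
have := sqr_ge0 a; have := e2E; rewrite /e2 b0 c0 e0 ad af expr2; lra.
Qed.

(** The two equalities place the axis of the antisymmetric part of [A] on the third basis vector. By
    [su2_torsion_nsym] that part is nonzero, so [A 0 1 - A 1 0] can be cancelled. *)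
Lemma su2_torsion_frame (R : realFieldType) (A : 'M[R]_3) :
  zero_torsion (@su2_bracket R) (mulmx A) ->
  A 2%:R 0 = A 0 2%:R -> A 2%:R 1 = A 1 2%:R ->
  exists x, A = mx3 [:: [:: 0; 1; 0]; [:: -1; 0; 0]; [:: 0; 0; x]]
   \/ A = mx3 [:: [:: 0; -1; 0]; [:: 1; 0; 0]; [:: 0; 0; x]].
Proof.
move=> TA s20 s21.
have s10 : A 0 1 - A 1 0 != 0.
  apply: contra (su2_torsion_nsym TA); rewrite subr_eq0 => /eqP s10.
  apply/eqP/matrixP; apply: ord3_ind; apply: ord3_ind; rewrite mxE //.
have E i j := su2_torsion_entry i j TA.
have := E 0 0; have := E 0 1; have := E 0 2%:R; have := E 1 1; have := E 1 2%:R.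
have := E 2%:R 2%:R; have := E 1 0; have := E 2%:R 0; have := E 2%:R 1.
move: s10; rewrite s20 s21 /= => s10 {E TA}.
rewrite !mulr0n !mulr1n !subr0.
set a := A 0 0; set b := A 0 1; set c := A 0 2%:R.
set b' := A 1 0; set d := A 1 1; set e := A 1 2%:R; set f := A 2%:R 2%:R.
move=> E21 E20 E10 E22 E12 E11 E02 E01 E00.
(* With S and W the symmetric and antisymmetric parts of [A], the next three
   facts are the entries of S W + W S = 0. *)
have c0 : c = 0 by apply/(mulfI s10); rewrite mulr0 -/b -/b'; lra.
have e0 : e = 0 by apply/(mulfI s10); rewrite mulr0 -/b -/b'; lra.
rewrite c0 e0 in E21 E20 E10 E22 E12 E11 E02 E01 E00.
have d0 : d = - a by apply/(mulfI s10); rewrite -/b -/b'; lra.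
rewrite d0 in E21 E20 E10 E22 E12 E11 E02 E01 E00.
(* The left side of [E22] is now 0, so e2 = 1; then [E00] and [E11] add up to 4 a^2 + (b + b')^2 =
   0. *)
have k0 : a ^+ 2 + (b + b') ^+ 2 = 0 by nra.
have a0 : a = 0 by nra.
have b'E : b' = - b by nra.
have : b ^+ 2 == 1.
  by move: E22; rewrite a0 b'E expr2 => E22; apply/eqP; lra.
rewrite sqrf_eq1 => b1; exists f.
case/orP: b1 => /eqP bE; [left | right]; apply/matrixP;
  apply: ord3_ind; apply: ord3_ind; rewrite mxE /=;
  rewrite ?s20 ?s21 -/a -/b -/c -/b' -/d -/e -/f ?c0 ?e0 ?d0 ?b'E ?a0 ?bE ?oppr0 ?opprK //.
Qed.

(** * Rotation to the third axis and the normal form of a single block *)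

(* The third column of [F] is [v / |v|]; the other two are completed
   explicitly from the projection of [v] on the plane of the first two axes. *)
Lemma rotation_to_axis (R : rcfType) (v : 'cV[R]_3) :
  v != 0 -> exists F : 'M[R]_3, SO F /\ exists2 r, r != 0 & v = F *m (r *: delta_mx 2%:R 0).
Proof.
move=> v0; pose a := v 0 0; pose b := v 1 0; pose c := v 2%:R 0.
have SO_intro (F : 'M[R]_3) r : F^T *m F = 1%:M -> \det F = 1 -> r != 0 ->
    F 0 2%:R * r = a -> F 1 2%:R * r = b -> F 2%:R 2%:R * r = c ->
  exists F : 'M[R]_3, SO F /\ exists2 r, r != 0 & v = F *m (r *: delta_mx 2%:R 0).
  move=> oF dF r0 Fa Fb Fc; exists F; split=> //; exists r => //.
  by apply/colP; apply: ord3_ind; rewrite mxE big_ord3 !mxE /= !mulr0n !mulr1n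
    !mulr0 !add0r !mulr1.
(* If v already lies on the third axis, the identity serves, since the factor [r] may be
   negative. *)
have [ab0|ab0] := eqVneq (a ^+ 2 + b ^+ 2) 0.
  have a0 : a = 0 by nra.
  have b0 : b = 0 by nra.
  have c0 : c != 0.
    apply: contra v0 => /eqP c0; apply/eqP/colP; apply: ord3_ind; rewrite mxE //.
  apply: (SO_intro 1%:M c); rewrite ?trmx1 ?mul1mx ?det1 // ?mxE /= ?a0 ?b0 ?mul0r ?mul1r //.
have ab_gt0 : 0 < a ^+ 2 + b ^+ 2 by rewrite lt_def ab0 addr_ge0 ?sqr_ge0.
pose r := Num.sqrt (a ^+ 2 + b ^+ 2); pose n := Num.sqrt (a ^+ 2 + b ^+ 2 + c ^+ 2).
have r0 : r != 0 by rewrite sqrtr_eq0 -ltNge.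
have n_gt0 : 0 < a ^+ 2 + b ^+ 2 + c ^+ 2 by rewrite ltr_wpDr ?sqr_ge0.
have n0 : n != 0 by rewrite sqrtr_eq0 -ltNge.
have r2 : r ^+ 2 = a ^+ 2 + b ^+ 2 by rewrite sqr_sqrtr ?ltW.
have n2 : n ^+ 2 = a ^+ 2 + b ^+ 2 + c ^+ 2 by rewrite sqr_sqrtr ?ltW.
(* Solved for c^2 and b^2 so that [field] can eliminate them when checking orthogonality and the
   determinant. *)
have c2 : c ^+ 2 = n ^+ 2 - r ^+ 2 by rewrite n2 r2; ring.
have b2 : b ^+ 2 = r ^+ 2 - a ^+ 2 by rewrite r2; ring.
pose F : 'M[R]_3 := mx3 [:: [:: - b / r; - a * c / (r * n); a / n];
                            [:: a / r;   - b * c / (r * n); b / n];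
                            [:: 0;       r / n;             c / n]].
apply: (SO_intro F n) => //; rewrite ?mxE /= ?divfK //.
  apply/matrixP; apply: ord3_ind; apply: ord3_ind; rewrite mxE big_ord3 !mxE /=.
  all: try by field: b2 c2; rewrite ?r0 ?n0.
by rewrite det3 !mxE /=; field: b2 c2; rewrite ?r0 ?n0.
Qed.

(** The inverse [f] of the automorphism [g] carries the torsion of g J f at (x, y) to the torsion of
    J at (f x, f y). *)
Lemma zero_torsion_conj (V : zmodType) (br : V -> V -> V)
    (f g : {additive V -> V}) (J : V -> V) :
  (forall x y, g (br x y) = br (g x) (g y)) -> cancel g f -> cancel f g ->
  zero_torsion br J -> zero_torsion br (fun x => g (J (f x))).
Proof.
move=> gbr gK fK TJ x y; have fbr u v : f (br u v) = br (f u) (f v).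
  by apply: (can_inj gK); rewrite fK gbr !fK.
by apply: (can_inj fK); rewrite !raddfB raddf0 !gK !fbr !gK TJ.
Qed.

Lemma zero_torsion_conjmx (R : comNzRingType) (n : nat)
    (br : 'cV[R]_n -> 'cV[R]_n -> 'cV[R]_n) (A P Q : 'M[R]_n) :
  (forall x y, P *m br x y = br (P *m x) (P *m y)) -> P *m Q = 1%:M ->
  zero_torsion br (mulmx A) <-> zero_torsion br (mulmx (Q *m A *m P)).
Proof.
move=> Pbr PQ; have QP := mulmx1C PQ.
have KP : cancel (mulmx P : 'cV_n -> 'cV_n) (mulmx Q).
  by move=> x; rewrite mulmxA QP mul1mx.
have KQ : cancel (mulmx Q : 'cV_n -> 'cV_n) (mulmx P).
  by move=> x; rewrite mulmxA PQ mul1mx.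
have Qbr x y : Q *m br x y = br (Q *m x) (Q *m y).
  by apply: (can_inj KP); rewrite Pbr !KQ.
split=> [/(zero_torsion_conj (f := mulmx P) (g := mulmx Q) Qbr KQ KP) T|
         /(zero_torsion_conj (f := mulmx Q) (g := mulmx P) Pbr KP KQ) T] x y.
  by rewrite -!mulmxA; apply: T.
by move: (T x y); rewrite /= !mulmxA PQ mul1mx -(mulmxA A P Q) PQ mulmx1.
Qed.

Definition su2_normal (R : comNzRingType) (x : R) : 'M[R]_3 :=
  mx3 [:: [:: 0; 1; 0]; [:: -1; 0; 0]; [:: 0; 0; x]].

Lemma SO_mul (R : comNzRingType) (n : nat) (F G : 'M[R]_n) :
  SO F -> SO G -> SO (F *m G).
Proof.
move=> [oF dF] [oG dG]; split; last by rewrite det_mulmx dF dG mulr1.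
by rewrite trmx_mul mulmxA -(mulmxA G^T) oF mulmx1.
Qed.

Lemma su2_torsion_normal (R : rcfType) (A : 'M[R]_3) :
  zero_torsion (@su2_bracket R) (mulmx A) ->
  exists2 F : 'M[R]_3, SO F & exists x, F^T *m A *m F = su2_normal x.
Proof.
move=> TA; pose W := A - A^T.
(* The axis of [W]: one has W x = [x, w], hence W w = 0. *)
pose w : 'cV[R]_3 := \col_a W (a + 1) (a + 2%:R).
have Ww : W *m w = 0.
  by apply/colP; apply: ord3_ind; rewrite !(mxE, big_ord3, ord3_add); ring.
have w0 : w != 0.
  apply: contra (su2_torsion_nsym TA) => /eqP/colP w0.
  have := (w0 0, w0 1, w0 2%:R); rewrite !(mxE, ord3_add) => -[[w00 w01] w02].
  apply/eqP/matrixP; apply: ord3_ind; apply: ord3_ind; rewrite mxE //; lra.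
have [F [SF [r r0 wE]]] := rotation_to_axis w0.
have TF : zero_torsion (@su2_bracket R) (mulmx (F^T *m A *m F)).
  have Fbr x y : F *m su2_bracket x y = su2_bracket (F *m x) (F *m y).
    exact: mulmx_su2_bracket.
  by apply/(zero_torsion_conjmx A Fbr (mulmx1C SF.1)).
(* After the rotation the antisymmetric part kills the third basis vector, so the third row and
   column of the rotated matrix agree. *)
have colW : F^T *m W *m F *m delta_mx 2%:R 0 = 0 :> 'cV_3.
  apply: (scalerI r0); rewrite scalemxAr -!mulmxA -wE Ww mulmx0 scaler0 //.
have symF i : (F^T *m A *m F) i 2%:R = (F^T *m A *m F) 2%:R i.
  have trF : F^T *m A^T *m F = (F^T *m A *m F)^T.
    by rewrite !trmx_mul trmxK mulmxA.
  have /colP/(_ i) := colW; rewrite -colE mulmxBr mulmxBl trF.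
  by move: (F^T *m A *m F) => B; rewrite !mxE => /subr0_eq.
have [x [FE|FE]] := su2_torsion_frame TF (esym (symF 0)) (esym (symF 1)).
  by exists F => //; exists x.
(* The half-turn exchanging the first two axes: conjugation by it flips the sign of the upper block
   and keeps [x]. *)
pose G : 'M[R]_3 := mx3 [:: [:: 0; 1; 0]; [:: 1; 0; 0]; [:: 0; 0; -1]].
have SG : SO G.
  split; last by rewrite det3 !mxE /=; ring.
  by apply/matrixP; apply: ord3_ind; apply: ord3_ind; rewrite !(mxE, big_ord3) /=; ring.
exists (F *m G); first exact: SO_mul.
exists x; rewrite trmx_mul (_ : _ *m _ = G^T *m (F^T *m A *m F) *m G); last by rewrite !mulmxA.
rewrite FE.
apply/matrixP; apply: ord3_ind; apply: ord3_ind; rewrite !(mxE, big_ord3) /= ?(mxE, big_ord3) /=; ring.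
Qed.

(** * Blocks of the torsion on a sum of copies of su(2) *)

Lemma su2_bracket0l (R : comNzRingType) (x : 'cV[R]_3) : su2_bracket 0 x = 0.
Proof. by apply/colP => c; rewrite !mxE; ring. Qed.

Lemma su2_bracket0r (R : comNzRingType) (x : 'cV[R]_3) : su2_bracket x 0 = 0.
Proof. by apply/colP => c; rewrite !mxE; ring. Qed.

Definition su2N_inj (R : comNzRingType) (N : nat) (k : 'I_N) (x : 'cV[R]_3) :
    su2N R N := \mxcol_(l < N) (if l == k then x else 0).

Lemma mulmx_su2N_inj (R : comNzRingType) (N : nat)
    (A : 'I_N -> 'I_N -> 'M[R]_3) (k : 'I_N) (x : 'cV[R]_3) :
  (\mxblock_(i < N, j < N) A i j) *m su2N_inj k x = \mxcol_i (A i k *m x).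
Proof.
rewrite mul_mxblock_mxrow; apply/eq_mxcol => i.
rewrite (bigD1 k) //= eqxx big1 ?addr0 // => j /negPf ->.
by rewrite mulmx0.
Qed.

Lemma su2N_bracket_injr (R : comNzRingType) (N : nat) (k : 'I_N)
    (X : su2N R N) (y : 'cV[R]_3) :
  su2N_bracket X (su2N_inj k y) = su2N_inj k (su2_bracket (submxcol X k) y).
Proof.
apply/eq_mxcol => i; rewrite mxcolK.
by case: eqP => [->|] //; rewrite su2_bracket0r.
Qed.

Lemma su2N_bracket_injl (R : comNzRingType) (N : nat) (k : 'I_N)
    (X : su2N R N) (y : 'cV[R]_3) :
  su2N_bracket (su2N_inj k y) X = su2N_inj k (su2_bracket y (submxcol X k)).
Proof.
apply/eq_mxcol => i; rewrite mxcolK.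
by case: eqP => [->|] //; rewrite su2_bracket0l.
Qed.

(** This is the component in factor [i] of the torsion on [x] in factor [j] and [y] in factor [k]. A
    bracket with [y] stays in factor [k] and one with [x] in factor [j], so each mixed term passes
    through a single block of the outer map. *)
Lemma su2N_torsion_block (R : comNzRingType) (N : nat)
    (A : 'I_N -> 'I_N -> 'M[R]_3) :
  zero_torsion (@su2N_bracket R N) (mulmx (\mxblock_(i, j) A i j)) ->
  forall i j k x y,
    su2_bracket (A i j *m x) (A i k *m y)
    - (if (i == k) && (j == k) then su2_bracket x y else 0)
    - A i k *m su2_bracket (A k j *m x) y
    - A i j *m su2_bracket x (A j k *m y) = 0.
Proof.
move=> T i j k x y.
have := T (su2N_inj j x) (su2N_inj k y).
rewrite !mulmx_su2N_inj !su2N_bracket_injr su2N_bracket_injl !mxcolK.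
rewrite !mulmx_su2N_inj => /(congr1 (fun Z => submxcol Z i)).
rewrite !submxcolB submxcol0 !mxcolK => H; rewrite -[RHS]H.
congr (_ - _ - _ - _); case: (i == k) => //=.
by rewrite [k == j]eq_sym; case: (j == k) => //; rewrite su2_bracket0l.
Qed.

Lemma su2N_torsion_diag (R : comNzRingType) (N : nat)
    (A : 'I_N -> 'I_N -> 'M[R]_3) (i : 'I_N) :
  zero_torsion (@su2N_bracket R N) (mulmx (\mxblock_(i, j) A i j)) ->
  zero_torsion (@su2_bracket R) (mulmx (A i i)).
Proof.
by move=> /su2N_torsion_block T x y; rewrite -[RHS](T i i i x y) eqxx.
Qed.

Lemma mxdiag_su2N_bracket (R : comNzRingType) (N : nat) (F : 'I_N -> 'M[R]_3)
    (X Y : su2N R N) : (forall i, SO (F i)) ->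
  \mxdiag_i F i *m su2N_bracket X Y =
  su2N_bracket (\mxdiag_i F i *m X) (\mxdiag_i F i *m Y).
Proof.
move=> SF; rewrite -[X]submxcolK -[Y]submxcolK !mul_mxdiag_mxcol.
by apply/eq_mxcol => i; rewrite !mxcolK mulmx_su2_bracket.
Qed.

(* Dotting [b1 x b2 = xi b0 - b1] with [b1] and [b2 x b0 = b0 + xi b1] with
   [b0], where the [b_a] are the columns of [B], gives [|b0|^2 + |b1|^2 = 0]. *)
Lemma su2_offdiag_col01 (R : realDomainType) (B : 'M[R]_3) (xi : R) :
  (forall x y, su2_bracket (B *m x) (B *m y)
     - B *m su2_bracket (su2_normal xi *m x) y
     - B *m su2_bracket x (su2_normal xi *m y) = 0) ->
  forall a, B a 0 = 0 /\ B a 1 = 0.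
Proof.
move=> T.
pose e a : 'cV[R]_3 := delta_mx a 0.
have BT p q z : su2_bracket (su2_normal xi *m e p) (e q)
      + su2_bracket (e p) (su2_normal xi *m e q) = z ->
    su2_bracket (B *m e p) (B *m e q) = B *m z.
  by move=> <-; apply/subr0_eq; rewrite mulmxDr opprD addrA; apply: T.
have /BT/colP B12 : su2_bracket (su2_normal xi *m e 1) (e 2%:R)
    + su2_bracket (e 1) (su2_normal xi *m e 2%:R) = xi *: e 0 - e 1.
  by apply/colP; apply: ord3_ind; rewrite !(mxE, big_ord3, ord3_add) /=; ring.
have /BT/colP B20 : su2_bracket (su2_normal xi *m e 2%:R) (e 0)
    + su2_bracket (e 2%:R) (su2_normal xi *m e 0) = e 0 + xi *: e 1.
  by apply/colP; apply: ord3_ind; rewrite !(mxE, big_ord3, ord3_add) /=; ring.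
have S0 : \sum_c (B c 0 ^+ 2 + B c 1 ^+ 2) = 0.
  have mE (z x y : R) : x = y -> z * x = z * y by move=> ->.
  have := (mE (B 0 1) _ _ (B12 0), mE (B 1 1) _ _ (B12 1), mE (B 2%:R 1) _ _ (B12 2%:R)).
  have := (mE (B 0 0) _ _ (B20 0), mE (B 1 0) _ _ (B20 1), mE (B 2%:R 0) _ _ (B20 2%:R)).
  rewrite big_ord3 mulmxBr mulmxDr -!scalemxAr -!colE !mxE !ord3_add.
  by case=> -[] H1 H2 H3 [] [] H4 H5 H6; lra.
move=> a; have /eqP : B a 0 ^+ 2 + B a 1 ^+ 2 = 0.
  by apply: (psumr_eq0P _ S0) => // c _; rewrite addr_ge0 ?sqr_ge0.
by rewrite paddr_eq0 ?sqr_ge0 // !sqrf_eq0 => /andP[/eqP-> /eqP->].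
Qed.

Lemma su2N_torsion_offdiag (R : realFieldType) (N : nat)
    (A : 'I_N -> 'I_N -> 'M[R]_3) (xi : 'I_N -> R) (i j : 'I_N) :
  zero_torsion (@su2N_bracket R N) (mulmx (\mxblock_(i, j) A i j)) ->
  (forall k, A k k = su2_normal (xi k)) -> i != j ->
  A i j = mx3 [:: [:: 0; 0; 0]; [:: 0; 0; 0]; [:: 0; 0; A i j 2%:R 2%:R]].
Proof.
move=> /su2N_torsion_block T AN ij.
have Tj x y := T i j j x y; rewrite (negPf ij) /= AN in Tj.
have Ti x y := T i j i x y; rewrite eqxx (eq_sym j) (negPf ij) /= AN in Ti.
have B01 : forall a, A i j a 0 = 0 /\ A i j a 1 = 0.
  by apply: (su2_offdiag_col01 (xi := xi j)) => x y; rewrite -[RHS](Tj x y) subr0.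
(* Let v be the last column of block (i, j) and s = [xi i]. Since [e_2, w] has no third coordinate
   for any w, the term through block (j, i) vanishes by [B01]. What remains is v_0 + s v_1 = 0 and
   v_1 - s v_0 = 0, with determinant 1 + s^2 > 0. *)
have {Tj T AN} := Ti (delta_mx 2%:R 0) (delta_mx 2%:R 0).
move: (A i j) (A j i) (xi i) B01 => {Ti}{}A B x A01 /colP T.
have [[[A00 A01'] [A10 A11]] [A20 A21]] := (A01 0, A01 1, A01 2%:R).
have := (T 0, T 1); rewrite !(mxE, big_ord3, ord3_add) /= !(A00, A01', A10, A11, A20, A21).
case=> T0 T1; apply/matrixP; apply: ord3_ind; apply: ord3_ind; rewrite mxE //=; nra.
Qed.

(** * Zero torsion of the matrices J(M) *)

Lemma submxcol_JM (R : comNzRingType) (N : nat) (M : 'M[R]_N) (X : su2N R N)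
    (i : 'I_N) :
  let x := submxcol X i in let z := submxcol (JM M *m X) i in
  [/\ z 0 0 = x 1 0, z 1 0 = - x 0 0 &
      z 2%:R 0 = \sum_j M i j * submxcol X j 2%:R 0].
Proof.
have -> : JM M *m X = JM M *m \mxcol_j submxcol X j by rewrite submxcolK.
rewrite /= mul_mxblock_mxrow mxcolK !summxE; split.
- rewrite (bigD1 i) //= eqxx big1 => [|j /negPf].
    by rewrite !(mxE, big_ord3) /=; ring.
  by rewrite eq_sym => ->; rewrite !(mxE, big_ord3) /=; ring.
- rewrite (bigD1 i) //= eqxx big1 => [|j /negPf].
    by rewrite !(mxE, big_ord3) /=; ring.
  by rewrite eq_sym => ->; rewrite !(mxE, big_ord3) /=; ring.
- apply: eq_bigr => j _; have [<-|_] := eqVneq i j;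
  by rewrite !mxE big_ord3 !mxE /=; ring.
Qed.

(** The third coordinate of a bracket is the area form of the first two coordinates, which the
    trace-free planar part of J(M) preserves infinitesimally. Hence [JX, Y] + [X, JY] has no third
    coordinates, its image under J(M) does not involve M, and the identity can be checked in each
    factor separately. *)
Lemma JM_zero_torsion (R : comNzRingType) (N : nat) (M : 'M[R]_N) :
  zero_torsion (@su2N_bracket R N) (mulmx (JM M)).
Proof.
move=> X Y; rewrite -addrA -opprD -mulmxDr.
pose Z := su2N_bracket (JM M *m X) Y + su2N_bracket X (JM M *m Y).
have Z2 j : submxcol Z j 2%:R 0 = 0.
  rewrite submxcolD !mxcolK; have [x0 x1 _] := submxcol_JM M X j.
  have [y0 y1 _] := submxcol_JM M Y j.
  move: x0 x1 y0 y1; move: (submxcol (JM M *m X) j) (submxcol (JM M *m Y) j).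
  move: (submxcol X j) (submxcol Y j) => x y u v x0 x1 y0 y1.
  by rewrite !mxE !ord3_add x0 x1 y0 y1; ring.
have Zi i : submxcol Z i = su2_bracket (submxcol (JM M *m X) i) (submxcol Y i)
    + su2_bracket (submxcol X i) (submxcol (JM M *m Y) i).
  by rewrite submxcolD !mxcolK.
apply/mxcolP => i; rewrite submxcol0 -/Z !submxcolB !mxcolK.
have [z0 z1 z2] := submxcol_JM M Z i.
have [x0 x1 x2] := submxcol_JM M X i; have [y0 y1 y2] := submxcol_JM M Y i.
have {}z2 : submxcol (JM M *m Z) i 2%:R 0 = 0.
  by rewrite z2; apply: big1 => j _; rewrite Z2 mulr0.
rewrite Zi in z0 z1; clear Zi Z2; clearbody Z.
move: x0 x1 x2 y0 y1 y2 z0 z1 z2; move: (submxcol (JM M *m Z) i).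
move: (submxcol (JM M *m X) i) (submxcol (JM M *m Y) i).
(* The third coordinates of JX and JY are the only link to other factors; the identity holds with
   arbitrary scalars in their place. *)
move: (\sum_j M i j * submxcol X j 2%:R 0) (\sum_j M i j * submxcol Y j 2%:R 0).
move: (submxcol X i) (submxcol Y i) => x y s t u v z.
move=> x0 x1 x2 y0 y1 y2; rewrite !mxE !ord3_add => z0 z1 z2.
by apply/colP; apply: ord3_ind;
  rewrite !(mxE, ord3_add) ?z0 ?z1 ?z2 ?x0 ?x1 ?y0 ?y1 ?x2 ?y2; ring.
Qed.

(** * Simultaneous normalisation of all factors *)

Theorem theorem3 (R : realType) (N : nat) (hN : (1 <= N)%N)
    (J : {linear su2N R N -> su2N R N}) :
  zero_torsion (@su2N_bracket R N) J <->
  exists Phi : 'M[R]_(\sum_(_ < N) 3), exists M : 'M[R]_N,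
    SO3N Phi /\ invmx Phi *m matrix_of J *m Phi = JM M.
Proof.
have -> : zero_torsion (@su2N_bracket R N) J <->
          zero_torsion (@su2N_bracket R N) (mulmx (matrix_of J)).
  by split=> T X Y; move: (T X Y); rewrite !matrix_ofE.
move: (matrix_of J) => A {J}.
have conj (F : 'I_N -> 'M[R]_3) : (forall i, SO (F i)) ->
    invmx (\mxdiag_i F i) = \mxdiag_i (F i)^T /\
    (zero_torsion (@su2N_bracket R N) (mulmx A) <->
     zero_torsion (@su2N_bracket R N)
       (mulmx (invmx (\mxdiag_i F i) *m A *m \mxdiag_i F i))).
  move=> SF; set P := \mxdiag_i F i.
  have QP : \mxdiag_i (F i)^T *m P = 1%:M.
    rewrite -mxdiagZ mul_mxdiag_mxblock; apply/eq_mxblock => i j.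
    case: (i == j); last by rewrite mulmx0.
    by rewrite !conform_mx_id; have [] := SF i.
  have [uQ uP] := mulmx1_unit QP.
  split; first by rewrite -[LHS]mul1mx -QP mulmxK.
  by apply: zero_torsion_conjmx (mulmxV uP) => X Y; apply: mxdiag_su2N_bracket.
split=> [TA|[_ [M [[F SF ->] AE]]]]; last first.
  by apply/(conj F SF).2; rewrite AE; apply: JM_zero_torsion.
pose B i j := submxblock A i j.
have AB : A = \mxblock_(i, j) B i j by rewrite submxblockK.
(* Each diagonal block has zero torsion on its own factor, so the rotations can be chosen factor by
   factor and assembled into one block-diagonal matrix. *)
have /fin_all_exists2[F SF FN] i :
    exists2 F, SO F & exists x, F^T *m B i i *m F = su2_normal x.
  by apply: su2_torsion_normal; apply: su2N_torsion_diag; rewrite -AB.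
have [xi xiE] := fin_all_exists FN.
pose C i j := (F i)^T *m B i j *m F j.
have [Vphi [/(_ TA) TC _]] := conj F SF.
have PAP : invmx (\mxdiag_i F i) *m A *m \mxdiag_i F i = \mxblock_(i, j) C i j.
  by rewrite Vphi AB mul_mxdiag_mxblock mul_mxblock_mxdiag.
exists (\mxdiag_i F i), (\matrix_(i, j) C i j 2%:R 2%:R).
split; first by exists F.
rewrite PAP in TC *; have {}xiE k : C k k = su2_normal (xi k) := xiE k.
clearbody C; apply/eq_mxblock => i j.
rewrite !mxE; have [<-|ij] := eqVneq i j.
  by rewrite !xiE /su2_normal mxE.
exact: su2N_torsion_offdiag TC xiE ij.
Qed.
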